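(* Let $G$ be a finitely generated para-$\mathfrak{Nil}$-Hamiltonian group containing a nilpotent subgroup of finite index. Then $\gamma_n(G)$ is finite for some positive integer $n$. Moreover, if $G$ is insoluble, then $G$ is finite.
   Context: A group is minimal non-nilpotent if it is not nilpotent but all its proper subgroups are nilpotent. A group $G$ is para-$\mathfrak{Nil}$-Hamiltonian if $G$ is non-nilpotent and every non-normal subgroup of $G$ is either nilpotent or minimal non-nilpotent. $\gamma_n(G)$ is the $n$-th term of the lower central series ($\gamma_1(G)=G$, $\gamma_{n+1}(G)=[\gamma_n(G),G]$). *)

(* Defs.v *)
From Stdlib Require Import List.

Record Group := {
  carrier :> Type;
  gmul : carrier -> carrier -> carrier;
  ginv : carrier -> carrier;
  gone : carrier;
  gmul_assoc : forall x y z, gmul x (gmul y z) = gmul (gmul x y) z;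
  gmul_1l : forall x, gmul gone x = x;
  gmul_1r : forall x, gmul x gone = x;
  gmul_Vl : forall x, gmul (ginv x) x = gone;
  gmul_Vr : forall x, gmul x (ginv x) = gone
}.

Section GroupDefs.
Variable G : Group.

Definition gset := G -> Prop.

Definition whole : gset := fun _ => True.

Definition subset (A B : gset) : Prop := forall x, A x -> B x.

Definition is_subgroup (H : gset) : Prop :=
  H (gone G) /\
  (forall x y, H x -> H y -> H (gmul G x y)) /\
  (forall x, H x -> H (ginv G x)).

Definition comm_el (x y : G) : G :=
  gmul G (gmul G (ginv G x) (ginv G y)) (gmul G x y).

Definition gen (S : gset) : gset :=
  fun x => forall K, is_subgroup K -> subset S K -> K x.

Definition comm_sub (A B : gset) : gset :=
  gen (fun x => exists a b, A a /\ B b /\ x = comm_el a b).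

(* lower central series of H: gamma H 1 = H, gamma H (n+1) = [gamma H n, H];
   (gamma H 0 := H by convention, never used with n = 0 below) *)
Fixpoint gamma (H : gset) (n : nat) : gset :=
  match n with
  | 0 => H
  | S 0 => H
  | S ((S _) as m) => comm_sub (gamma H m) H
  end.

Fixpoint derived (H : gset) (n : nat) : gset :=
  match n with
  | 0 => H
  | S m => comm_sub (derived H m) (derived H m)
  end.

Definition trivial_set (A : gset) : Prop := forall x, A x -> x = gone G.

Definition nilpotent (H : gset) : Prop := exists n, trivial_set (gamma H n).

Definition soluble (H : gset) : Prop := exists n, trivial_set (derived H n).

Definition normal (H : gset) : Prop :=
  forall g h, H h -> H (gmul G (gmul G (ginv G g) h) g).

Definition proper_sub (K H : gset) : Prop :=
  subset K H /\ exists x, H x /\ ~ K x.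

Definition minimal_non_nilpotent (H : gset) : Prop :=
  ~ nilpotent H /\
  forall K, is_subgroup K -> proper_sub K H -> nilpotent K.

Definition para_Nil_Hamiltonian : Prop :=
  ~ nilpotent whole /\
  forall H, is_subgroup H -> ~ normal H ->
    nilpotent H \/ minimal_non_nilpotent H.

Definition finite_set (A : gset) : Prop :=
  exists l : list G, forall x, A x -> In x l.

Definition finitely_generated : Prop :=
  exists l : list G, forall x, gen (fun y => In y l) x.

Definition finite_index (H : gset) : Prop :=
  exists l : list G, forall x, exists t, In t l /\ H (gmul G (ginv G t) x).

End GroupDefs.

(* Main.v *)
(** The normal core [N] of the given subgroup is finitely generated and nilpotent.
    Each factor [A / B] of its lower central series has a homomorphism [phi] to some
    [Z^n] with finite kernel, and [g] acts on the image of [phi] by conjugation,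
    with finite order. Consider the subgroups [L_k = A_k C_G(g)], where [A_k] is the
    preimage of [2^k phi A]; if [a] lies in [L_k], then [phi [a, g]] is divisible
    by [2^k]. If some [L_k] is nilpotent, [g] acts unipotently, hence trivially. If
    all are normal, each contains every [[a, g]]; if [L_k] is minimal non-nilpotent,
    it equals each [L_(k+j)]; in both cases [phi [a, g] = 0] again. So [phi] is
    invariant under conjugation by [G]. If [gamma_n G] is finite modulo [A], the
    transfer extends a multiple of [phi] to [gamma_n G], and its kernel contains
    [gamma_(n+1) G] and is finite modulo [B]; descending the lower central series
    of [N], some [gamma_n G] is finite.

    If [G] is infinite, some [z] of infinite order centralises the finite group
    [F = gamma_n G]. For a non-nilpotent subgroup [X] of [F], the subgroup [X <z>]
    is not minimal non-nilpotent, hence normal, and so is [X = X <z> :&: F] in [F].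
    A finite group whose subgroups are all nilpotent or normal is soluble, by a
    theorem of Schmidt that is deduced here from the theorem of Frobenius. *)

From HB Require Import structures.
From mathcomp Require Import all_boot all_fingroup all_solvable all_algebra.
From mathcomp Require Import vcharacter.
From mathcomp Require Import boolp.
From mathcomp Require classical_sets.
Require Defs.

Set Implicit Arguments.
Unset Strict Implicit.
Unset Printing Implicit Defensive.

Import GroupScope GRing.Theory Num.Theory.

(** * Finite groups whose subgroups are nilpotent or normal *)

Lemma maximal_proper_setI (gT : finGroupType) (G A B : {group gT}) :
  maximal A G -> maximal B G -> A :!=: B -> A :&: B \proper A.
Proof.
move=> maxA maxB neqAB; rewrite properE subsetIl subsetI subxx /=.
apply: contra neqAB => sAB.
by have [_ /(_ B (maxgroupp maxB) sAB)->] := maxgroupP maxA.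
Qed.

Section SimpleMinimalNonnilpotent.
Variables (gT : finGroupType) (G : {group gT}).
Hypothesis simpleG : simple G.
Hypothesis nilpotent_proper : forall H : {group gT}, H \proper G -> nilpotent H.
Implicit Types H M : {group gT}.

Lemma simple_norm_proper H : H :!=: 1 -> H \proper G -> 'N_G(H) \proper G.
Proof.
move=> ntH prH; rewrite properEneq subsetIl andbT; apply: contra_neq ntH => nHG.
have [_ /(_ H)[|//|HG]] := simpleP G simpleG; last by rewrite HG properxx in prH.
by rewrite /normal proper_sub // -{1}nHG subsetIr.
Qed.

Lemma simple_norm_maximal M : maximal M G -> M :!=: 1 -> 'N_G(M) = M.
Proof.
move=> maxM ntM; have /maxgroupP[prM] := maxM; apply.
  exact: (simple_norm_proper (H := M)).
by rewrite subsetI normG proper_sub.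
Qed.

(* In a counterexample with [A :&: B] as large as possible, nilpotency makes
   ['N_A(A :&: B)] and ['N_B(A :&: B)] larger than [A :&: B], so that [A] and [B]
   both coincide with any maximal subgroup containing ['N_G(A :&: B)]. *)
Lemma simple_maximal_TI M1 M2 :
  maximal M1 G -> maximal M2 G -> M1 :!=: M2 -> M1 :&: M2 = 1.
Proof.
move=> maxM1 maxM2 neqM; apply/eqP/contraT => ntI.
pose bad (p : {group gT} * {group gT}) :=
  [&& maximal p.1 G, maximal p.2 G, p.1 :!=: p.2 & p.1 :&: p.2 != 1].
have badM : bad (M1, M2) by apply/and4P.
have [[A B] /= /and4P[/= maxA maxB neqAB ntAB] largest] :=
  arg_maxnP (fun p : {group gT} * {group gT} => #|p.1 :&: p.2|) badM.
pose I := (A :&: B)%G.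
have prI : I \proper G := sub_proper_trans (subsetIl A B) (maxgroupp maxA).
have [C maxC sNC] : exists2 C : {group gT}, maximal C G & 'N_G(I) \subset C.
  have prN := simple_norm_proper (H := I) ntAB prI.
  have [NG|//] := maximal_exists (H := 'N_G(I)%G) (proper_sub prN).
  by rewrite NG properxx in prN.
have eq_C (D : {group gT}) : maximal D G -> I \proper D -> D :=: C.
  move=> maxD prID; have prD := maxgroupp maxD.
  have ltN := nilpotent_proper_norm (nilpotent_proper prD) prID.
  have ltDC : I \proper D :&: C.
    rewrite (proper_sub_trans ltN) // subsetI subsetIl (subset_trans _ sNC) //.
    by rewrite setSI // proper_sub.
  apply: contraTeq (proper_card ltDC) => neqDC; rewrite -leqNgt.
  apply: (largest (D, C)).
  apply/and4P; split=> //=; apply: contraTneq ltDC => ->.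
  by rewrite properE sub1G andbF.
have prIA : I \proper A := maximal_proper_setI maxA maxB neqAB.
have prIB : I \proper B.
  by rewrite /= setIC (maximal_proper_setI maxB maxA) // eq_sym.
by case/eqP: neqAB; rewrite (eq_C A maxA prIA) (eq_C B maxB prIB).
Qed.

Lemma simple_maximal_normedTI M : maximal M G -> M :!=: 1 -> normedTI M^# G M.
Proof.
move=> maxM ntM; apply/normedTI_P; split; first by rewrite setD_eq0 subG1.
  by rewrite normD1 simple_norm_maximal.
move=> g Gg; rewrite -setI_eq0 conjD1g -setDIl setD_eq0 subG1.
apply: contraR => nMg; have /= -> // := simple_maximal_TI (M2 := (M :^ g)%G) maxM.
  by rewrite -(conjGid Gg) (maximalJ M G g).
apply: contra nMg => /eqP eqM; rewrite -(simple_norm_maximal maxM ntM).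
by rewrite inE Gg; apply/normP.
Qed.

(* Otherwise any maximal subgroup is a Frobenius complement, and the Frobenius
   kernel is a proper nontrivial normal subgroup. *)
Lemma simple_minimal_nonnilpotent_cyclic : cyclic G.
Proof.
have [ntG noN] := simpleP G simpleG; apply: contraT => ncycG.
have [x Gx ntx] := trivgPn _ ntG.
have sxG : <[x]> \subset G by rewrite cycle_subG.
have [xG|[M maxM sxM]] := maximal_exists sxG.
  by case/negP: ncycG; rewrite -xG cycle_cyclic.
have ntM : M :!=: 1.
  by apply: contraNneq ntx => M1; rewrite -cycle_eq1 -subG1 -M1.
have frobM : [Frobenius G with complement M].
  have neqMG := proper_neq (maxgroupp maxM).
  by rewrite /Frobenius_group_with_complement neqMG simple_maximal_normedTI.
have [K frobK] := Frobenius_kernel_exists frobM.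
have [defG ntK _ prK _] := Frobenius_context frobK.
have [nKG _ _ _ _] := sdprod_context defG.
have [K1|KG] := noN K nKG; first by rewrite K1 eqxx in ntK.
by rewrite KG properxx in prK.
Qed.
End SimpleMinimalNonnilpotent.

Lemma solvable_nilpotent_or_normal (gT : finGroupType) (G : {group gT}) :
  (forall H : {group gT}, H \subset G -> nilpotent H \/ H <| G) -> solvable G.
Proof.
have [n] := ubnP #|G|; elim: n gT G => // n IHn gT G leGn nilG.
have [-> | ntG] := eqVneq (G : {set gT}) 1; first exact: solvable1.
have [/existsP[N /and3P[nsN ntN neN]] | noN] :=
    boolP [exists N : {group gT}, [&& N <| G, N :!=: 1 & N :!=: G]].
  have sNG := normal_sub nsN; rewrite (series_sol nsN); apply/andP; split.
    apply: IHn => [|H sHN].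
      by apply: leq_trans (proper_card _) leGn; rewrite properEneq neN.
    have [nilH|nsH] := nilG H (subset_trans sHN sNG); first by left.
    by right; apply: normalS nsH.
  apply: IHn => [|_ /(inv_quotientS nsN)[H -> _ /nilG[nilH|nsH]]].
  - exact: leq_trans (ltn_quotient ntN sNG) leGn.
  - by left; apply: quotient_nil.
  - by right; apply: quotient_normal.
have simpleG : simple G.
  apply/simpleP; split=> // N nsN; move/existsPn/(_ N): noN.
  by rewrite nsN /= negb_and !negbK => /orP[]/eqP; [left | right].
apply/abelian_sol/cyclic_abelian/simple_minimal_nonnilpotent_cyclic => // H prH.
have [//|nsH] := nilG H (proper_sub prH).
have [_ /(_ H nsH)[->|HG]] := simpleP G simpleG; first exact: nilpotent1.
by rewrite HG properxx in prH.
Qed.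

(** * Finitely generated abelian groups *)

Section IntegerVectors.
Local Open Scope ring_scope.
Variables m n : nat.
Implicit Types A B : 'M[int]_(m, n).

Lemma mx_mulrz_eq0 A (k : int) : (A *~ k == 0) = (k == 0) || (A == 0).
Proof. by rewrite -scaler_int intz scalemx_eq0. Qed.

Lemma mx_mulrn_eq0 A k : (0 < k)%N -> A *+ k = 0 -> A = 0.
Proof.
by rewrite lt0n pmulrn => /negPf k0 /eqP; rewrite mx_mulrz_eq0 [_ == 0]k0 => /eqP.
Qed.

Lemma mx_divisible_eq0 A : (forall k, exists B, A = B *+ 2 ^ k) -> A = 0.
Proof.
move=> divA; apply/matrixP => i j; rewrite mxE; apply/eqP; apply: contraT => nz.
have [B /matrixP/(_ i j)] := divA `|A i j|%N; rewrite mulmxnE -mulr_natr natz.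
move=> /(congr1 absz); rewrite abszM => normA.
have : (2 ^ `|A i j| %| `|A i j|)%N by apply/dvdnP; exists `|B i j|%N.
by move/dvdn_leq; rewrite absz_gt0 nz leqNgt ltn_expl // => /(_ erefl).
Qed.
End IntegerVectors.

Section LinearCombinations.
Local Open Scope ring_scope.
Variables (V : zmodType) (k : nat) (a : 'I_k -> V) (J : {set 'I_k}).
Implicit Types (c d : 'rV[int]_k).

Definition lincomb c := \sum_(i in J) a i *~ c 0 i.

Lemma lincombB c d : lincomb (c - d) = lincomb c - lincomb d.
Proof. by rewrite -sumrB; apply: eq_bigr => i _; rewrite !mxE mulrzBr. Qed.

Lemma lincombZ n c : lincomb (n *: c) = lincomb c *~ n.
Proof.
by rewrite /lincomb mulrz_suml; apply: eq_bigr => i _; rewrite mxE mulrC mulrzA.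
Qed.

Lemma lincomb0 : lincomb 0 = 0.
Proof. by rewrite -(scale0r 0) lincombZ mulr0z. Qed.

Lemma lincomb_delta i : i \in J -> lincomb (delta_mx 0 i) = a i.
Proof.
move=> iJ; rewrite /lincomb (bigD1 i) //= mxE !eqxx big1 ?addr0 // => j /andP[_ ji].
by rewrite mxE (negPf ji) andbF mulr0z.
Qed.
End LinearCombinations.

Section LatticeQuotient.
Local Open Scope ring_scope.
Variables (V : zmodType) (k : nat) (a : 'I_k -> V).
Hypothesis spanV : forall v, exists c, v = lincomb a [set: 'I_k] c.
Implicit Types (J : {set 'I_k}) (c : 'rV[int]_k) (v w : V).

Definition independent J :=
  `[< forall c, lincomb a J c = 0 -> forall i, i \in J -> c 0 i = 0 >].

Lemma maxset_independent_multiple J i : maxset independent J ->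
  exists2 m : int, m != 0 & exists c, a i *~ m = lincomb a J c.
Proof.
move=> maxJ; have [iJ|iJ] := boolP (i \in J).
  by exists 1 => //; exists (delta_mx 0 i); rewrite lincomb_delta.
have [indepJ maxJ'] := maxsetP maxJ.
have /asboolPn/existsNP[c /not_implyP[c0 /existsNP[j /not_implyP[jJ /eqP cj]]]] :
    ~~ independent (i |: J).
  by apply: contra iJ => /maxJ'/(_ (subsetUr _ _)) <-; rewrite setU11.
have {}c0 : a i *~ c 0 i + lincomb a J c = 0 by rewrite -c0 /lincomb big_setU1.
exists (c 0 i); last first.
  exists (-1 *: c); rewrite lincombZ mulrN1z.
  by apply/eqP; rewrite -addr_eq0 c0.
apply: contraNneq cj => ci; move: c0; rewrite ci mulr0z add0r => Jc.
move: jJ; rewrite !inE => /orP[/eqP->|jJ]; first by rewrite ci.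
by move/asboolP: indepJ => /(_ c Jc j jJ)->.
Qed.

Lemma maxset_independent_common_multiple J : maxset independent J ->
  exists2 m : int, m != 0 & forall v, exists c, v *~ m = lincomb a J c.
Proof.
move=> maxJ.
have /choice[m mP] i : exists m : int, m != 0 /\ exists c, a i *~ m = lincomb a J c.
  by have [m] := maxset_independent_multiple i maxJ; exists m.
exists (\prod_i m i) => [|v]; first by apply/prodf_neq0 => i _; have [] := mP i.
have [c ->] := spanV v; rewrite mulrz_suml.
elim/big_rec: (\sum_(i in _) _) => [|i w _ [d ->]].
  by exists 0; rewrite lincomb0.
have [_ [e ame]] := mP i.
exists (d - (- (c 0 i * \prod_(j | j != i) m j)) *: e).
by rewrite lincombB lincombZ -ame mulrNz opprK addrC (bigD1 i) //= -!mulrzA mulrCA.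
Qed.

(* [phi v] collects the coordinates of [v *~ m] on a maximal independent subfamily
   of the generators. *)
Lemma torsion_kernel_morphism : exists (phi : {additive V -> 'rV[int]_k}) (m : int),
  m != 0 /\ forall v, phi v = 0 -> v *~ m = 0.
Proof.
have [J maxJ] : exists J, maxset independent J.
  have [|J maxJ _] := @maxset_exists _ independent set0; last by exists J.
  by apply/asboolP => c _ i; rewrite inE.
have [m m_neq0 mP] := maxset_independent_common_multiple maxJ.
have /choice[phi phiP] v : exists c : 'rV[int]_k,
    v *~ m = lincomb a J c /\ forall i, i \notin J -> c 0 i = 0.
  have [c ->] := mP v; exists (\row_i if i \in J then c 0 i else 0); split.
    by apply: eq_bigr => i iJ; rewrite mxE iJ.
  by move=> i /negPf iJ; rewrite mxE iJ.
have phiB : zmod_morphism phi.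
  move=> v w; apply/rowP => i; rewrite !mxE.
  have [[vE v0] [wE w0]] := (phiP v, phiP w); have [vwE vw0] := phiP (v - w).
  have [iJ|iJ] := boolP (i \in J); last by rewrite v0 // w0 // vw0 // subrr.
  have /maxsetp/asboolP/(_ (phi (v - w) - (phi v - phi w))) := maxJ.
  rewrite !lincombB -vE -wE -vwE mulrzBl subrr => /(_ erefl i iJ) /eqP.
  by rewrite !mxE subr_eq0 => /eqP.
pose phi_add := GRing.isZmodMorphism.Build V 'rV[int]_k phi phiB.
pose phi_additive : {additive V -> 'rV[int]_k} := HB.pack phi phi_add.
exists phi_additive, m.
split=> // v /= phi0; have [-> _] := phiP v.
by rewrite phi0 lincomb0.
Qed.

Lemma finite_kernel_morphism : exists phi : {additive V -> 'rV[int]_k},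
  exists (C : finType) (colour : V -> C),
    forall v w, phi v = phi w -> colour v = colour w -> v = w.
Proof.
have [phi [m [m_neq0 ker_phi]]] := torsion_kernel_morphism.
have /choice[c cP] := spanV.
have lt_mod (x : int) : (`|(x %% m)%Z| < `|m|)%N.
  by rewrite -ltz_nat !abszE ger0_norm ?modz_ge0 ?ltz_mod.
exists phi, {ffun 'I_k -> 'I_`|m|}.
exists (fun v => [ffun i => Ordinal (lt_mod (c v ord0 i))]).
move=> v w phivw residues; apply/eqP; rewrite -subr_eq0; apply/eqP.
have /choice[q qP] i : exists q, c v 0 i - c w 0 i = q * m.
  have /ffunP/(_ i) := residues; rewrite !ffunE => /(congr1 val) /= /(congr1 Posz).
  rewrite !abszE !ger0_norm ?modz_ge0 // => /eqP; rewrite eqz_mod_dvd.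
  exact: dvdzP.
have vwE : v - w = lincomb a [set: 'I_k] (\row_i q i) *~ m.
  rewrite [v]cP [w]cP -lincombB -lincombZ; congr lincomb; apply/rowP => i.
  by rewrite !mxE qP mulrC.
rewrite vwE; apply: ker_phi; apply/eqP.
have : phi (v - w) = 0 by rewrite raddfB phivw subrr.
by rewrite vwE raddfMz => /eqP; rewrite mx_mulrz_eq0 (negPf m_neq0).
Qed.
End LatticeQuotient.

Import classical_sets Defs.
Local Open Scope classical_set_scope.

(** * Subgroups and the lower central series *)

HB.instance Definition _ (G : Group) := gen_eqMixin G.
HB.instance Definition _ (G : Group) := gen_choiceMixin G.
HB.instance Definition _ (G : Group) := isGroup.Build G
  (@gmul_assoc G) (@gmul_1l G) (@gmul_1r G) (@gmul_Vl G) (@gmul_Vr G).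

Bind Scope group_scope with carrier.

Lemma comm_elE (G : Group) (x y : G) : comm_el G x y = [~ x, y].
Proof. by rewrite commgEl conjgE mulgA. Qed.

Section Subgroup.
Variables (G : Group) (H : set G).
Implicit Types x y z : G.

Lemma is_subgroup_div : H 1 -> (forall x y, H x -> H y -> H (x * y^-1)) ->
  is_subgroup G H.
Proof.
move=> H1 HF; have HV x : H x -> H x^-1 by rewrite -[x^-1]mul1g; apply: HF.
by split=> //; split=> // x y Hx Hy; rewrite -[y]invgK; apply/HF/HV.
Qed.

Hypothesis sH : is_subgroup G H.

Lemma subgroup1 : H 1. Proof. by case: sH. Qed.

Lemma subgroupM x y : H x -> H y -> H (x * y).
Proof. by case: sH => _ [HM _]; apply: HM. Qed.

Lemma subgroupV x : H x -> H x^-1.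
Proof. by case: sH => _ [_ HV]; apply: HV. Qed.

Lemma subgroupF x y : H x -> H y -> H (x * y^-1).
Proof. by move=> Hx /subgroupV; apply: subgroupM. Qed.

Lemma subgroupVM x y : H x -> H y -> H (x^-1 * y).
Proof. by move/subgroupV; apply: subgroupM. Qed.

Lemma subgroupKM x y : H x -> H (x * y) -> H y.
Proof. by move=> Hx Hxy; rewrite -(mulKg x y); apply: subgroupVM. Qed.

Lemma subgroupJ x y : H x -> H y -> H (x ^ y).
Proof. by move=> Hx Hy; apply: subgroupVM => //; apply: subgroupM. Qed.

Lemma subgroupX x n : H x -> H (x ^+ n).
Proof.
move=> Hx; elim: n => [|n IHn]; first exact: subgroup1.
by rewrite expgS; apply: subgroupM.
Qed.

Lemma lcoset_sym x y : H (x^-1 * y) -> H (y^-1 * x).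
Proof. by move/subgroupV; rewrite invgM invgK. Qed.

Lemma lcoset_trans x y z : H (x^-1 * y) -> H (y^-1 * z) -> H (x^-1 * z).
Proof. by move=> Hxy /(subgroupM Hxy); rewrite -mulgA mulVKg. Qed.
End Subgroup.

Section SubgroupConstructions.
Variable G : Group.
Implicit Types (C D F K : set G) (g x y z : G) (m n : nat).

Definition centralizer F : set G := [set g | forall x, F x -> commute x g].

Lemma centralizer_subgroup F : is_subgroup G (centralizer F).
Proof.
apply: is_subgroup_div => [x _|g h Cg Ch x Fx]; first exact: commute1.
by apply: commuteM (Cg x Fx) (commuteV (Ch x Fx)).
Qed.

Definition infinite_order z := forall m, 0 < m -> z ^+ m <> 1.

Definition powers z : set G := [set y | exists m n, y = z ^+ m * z ^- n].

Lemma powers_subgroup z : is_subgroup G (powers z).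
Proof.
apply: is_subgroup_div => [|_ _ [m [n ->]] [p [q ->]]].
  by exists 0%N, 0%N; rewrite mulgV.
exists (m + q)%N, (n + p)%N; rewrite [(n + p)%N]addnC !expgnDr !invgM invgK.
rewrite -!mulgA; congr (_ * _); rewrite !mulgA; congr (_ * _).
exact/commute_sym/commuteV/commuteX2.
Qed.

Lemma mem_powers z : powers z z.
Proof. by exists 1%N, 0%N; rewrite invg1 mulg1. Qed.

Lemma powers_min z K : is_subgroup G K -> K z -> powers z `<=` K.
Proof.
by move=> sK Kz _ [m [n ->]]; apply: (subgroupF sK); apply: subgroupX.
Qed.

Definition prod_set D C : set G := [set x * c | x in D & c in C].

Section Product.
Variables D C : set G.
Hypotheses (sD : is_subgroup G D) (sC : is_subgroup G C).
Hypothesis normDC : forall x c, D x -> C c -> D (x ^ c).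

Lemma prod_subgroup : is_subgroup G (prod_set D C).
Proof.
apply: is_subgroup_div => [|_ _ [x Dx [c Cc <-]] [y Dy [d Cd <-]]].
  exists 1; first exact: subgroup1.
  by exists 1; [exact: subgroup1 | rewrite mulg1].
have Ccd := subgroupF sC Cc Cd; exists (x * (y^-1) ^ (c * d^-1)^-1).
  apply: (subgroupM sD) => //; apply: normDC; exact: subgroupV.
by exists (c * d^-1) => //; rewrite /conjg !gnorm.
Qed.

Lemma prod_subl : D `<=` prod_set D C.
Proof.
by move=> x Dx; exists x => //; exists 1; [exact: subgroup1 | rewrite mulg1].
Qed.

Lemma prod_subr : C `<=` prod_set D C.
Proof.
by move=> c Cc; exists 1; [exact: subgroup1 | exists c; rewrite ?mul1g].
Qed.
End Product.
End SubgroupConstructions.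

Section LowerCentralSeries.
Variable G : Group.
Implicit Types (A B H K S : set G) (a g x : G).

Lemma is_subgroup_conj H g : is_subgroup G H -> is_subgroup G [set x | H (x ^ g)].
Proof.
move=> sH; apply: is_subgroup_div => [|x y Hx Hy] /=.
  by rewrite conj1g; apply: subgroup1.
by rewrite conjMg conjVg; apply: subgroupF.
Qed.

Lemma subset_gen S : S `<=` gen G S.
Proof. by move=> x Sx K _; apply. Qed.

Lemma gen_subgroup S : is_subgroup G (gen G S).
Proof.
apply: is_subgroup_div => [K sK _|x y Sx Sy K sK SK]; first exact: subgroup1.
by apply: subgroupF => //; [apply: Sx | apply: Sy].
Qed.

Lemma gen_min S K : is_subgroup G K -> S `<=` K -> gen G S `<=` K.
Proof. by move=> sK SK x; apply. Qed.

Lemma gen_conj S g :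
  (forall x, S x -> S (x ^ g)) -> forall x, gen G S x -> gen G S (x ^ g).
Proof.
move=> Sg; apply: (gen_min (K := [set x | gen G S (x ^ g)])).
  exact/is_subgroup_conj/gen_subgroup.
by move=> x /Sg; apply: subset_gen.
Qed.

Lemma comm_sub_min A B K : is_subgroup G K ->
  (forall a b, A a -> B b -> K [~ a, b]) -> comm_sub G A B `<=` K.
Proof.
move=> sK KAB; apply: gen_min => // _ [a [b [Aa [Bb ->]]]].
by rewrite comm_elE; apply: KAB.
Qed.

Lemma mem_comm_sub A B a b : A a -> B b -> comm_sub G A B [~ a, b].
Proof. by move=> Aa Bb; apply: subset_gen; exists a, b; rewrite comm_elE. Qed.

Lemma comm_sub_mono A A' B B' :
  A `<=` A' -> B `<=` B' -> comm_sub G A B `<=` comm_sub G A' B'.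
Proof.
move=> sA sB; apply: comm_sub_min => [|a b /sA Aa /sB Bb].
  exact: gen_subgroup.
exact: mem_comm_sub.
Qed.

Lemma derived_mono H K n : H `<=` K -> derived G H n `<=` derived G K n.
Proof. by move=> sHK; elim: n => [//|n IHn]; apply: comm_sub_mono. Qed.

Lemma derivedD H m n : derived G H (m + n) = derived G (derived G H m) n.
Proof. by elim: n => [|n IHn]; rewrite ?addn0 // addnS /= IHn. Qed.

Lemma gamma_mono H K n : H `<=` K -> gamma G H n `<=` gamma G K n.
Proof. by move=> sHK; elim: n => [//|[//|n] IHn]; apply: comm_sub_mono. Qed.

Lemma nilpotent_sub H K : H `<=` K -> nilpotent G K -> nilpotent G H.
Proof. by move=> sHK [n Kn1]; exists n => x /(gamma_mono sHK)/Kn1. Qed.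

Section Gamma.
Variable H : set G.
Hypothesis sH : is_subgroup G H.

Lemma gamma_subgroup n : is_subgroup G (gamma G H n).
Proof. by case: n => [|[|n]] //; apply: gen_subgroup. Qed.

Lemma gamma_conj g n : (forall x, H x -> H (x ^ g)) ->
  forall x, gamma G H n x -> gamma G H n (x ^ g).
Proof.
move=> Hg; elim: n => [//|[//|n] IHn]; apply: gen_conj => _ [a [b [Ha [Hb ->]]]].
exists (a ^ g), (b ^ g); rewrite !comm_elE conjRg.
by split; [apply: IHn | split; [apply: Hg |]].
Qed.

Lemma gamma_comm n a b : gamma G H n.+1 a -> H b -> gamma G H n.+2 [~ a, b].
Proof. exact: mem_comm_sub. Qed.

Lemma gamma_decr n : gamma G H n.+1 `<=` gamma G H n.
Proof.
case: n => [//|n]; apply: comm_sub_min => [|a b Ha Hb].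
  exact: gamma_subgroup.
rewrite commgEl; apply: (subgroupVM (gamma_subgroup _)) => //.
by apply: gamma_conj => // x Hx; apply: subgroupJ.
Qed.

Lemma gamma_sub n : gamma G H n `<=` H.
Proof. by elim: n => [//|n IHn] x /gamma_decr/IHn. Qed.
End Gamma.

Lemma normalP H : normal G H <-> (forall x g, H x -> H (x ^ g)).
Proof.
split=> nH => [x g|g x] Hx; first by rewrite conjgE mulgA; apply: nH.
by have := nH x g Hx; rewrite conjgE mulgA.
Qed.

Lemma gamma_normal H n : normal G H -> normal G (gamma G H n).
Proof.
by move/normalP=> nH; apply/normalP => x g; apply: gamma_conj => y; apply: nH.
Qed.

Lemma derived_sub_gamma n : derived G setT n `<=` gamma G setT n.+1.
Proof. by elim: n => [//|n IHn]; apply: comm_sub_mono. Qed.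

Lemma soluble_gamma n : soluble G (gamma G setT n) -> soluble G setT.
Proof.
case: n => [//|n] [k trivial_k]; exists (n + k)%N => x; rewrite derivedD.
by move/(derived_mono (@derived_sub_gamma n))/trivial_k.
Qed.

End LowerCentralSeries.

(** * Finiteness modulo a subgroup *)

(* For subgroups, [S :&: M] has finite index in [S]: elements of [S] of the same
   colour lie in the same left coset of [M]. *)
Definition finite_mod (G : Group) (S M : set G) :=
  exists (C : finType) (colour : G -> C),
    forall x y, S x -> S y -> colour x = colour y -> M (x^-1 * y).

(* The representative depends only on the coset [x M]; it is [1] if [x M] does not
   meet [S]. *)
Definition coset_rep (G : Group) (S M : set G) (x : G) : G :=
  xget 1 [set y | S y /\ M (y^-1 * x)].

Definition transversal (G : Group) (S M : set G) (T : seq G) :=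
  uniq T /\ forall t, t \in T <-> S t /\ coset_rep S M t = t.

Section CosetRepresentatives.
Variables (G : Group) (S M : set G).
Hypothesis sM : is_subgroup G M.
Local Notation rep := (coset_rep S M).

Lemma coset_repP x : S x -> S (rep x) /\ M ((rep x)^-1 * x).
Proof.
move=> Sx; apply: (xgetPex 1 (P := [set y | S y /\ M (y^-1 * x)])).
by exists x; rewrite /= mulVg; split=> //; apply: subgroup1.
Qed.

Lemma coset_rep_eq x y : M (x^-1 * y) -> rep x = rep y.
Proof.
move=> Mxy; congr xget; apply/seteqP; split=> z [Sz Mz]; split=> //.
  exact: lcoset_trans Mz Mxy.
by apply: (lcoset_trans sM Mz); apply: lcoset_sym.
Qed.

Lemma coset_rep_inj x y : S x -> S y -> rep x = rep y -> M (x^-1 * y).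
Proof.
move=> /coset_repP[_ Mx] /coset_repP[_ My] eq_rep.
by apply: (lcoset_trans sM (lcoset_sym sM Mx)); rewrite eq_rep.
Qed.

Lemma coset_repMr x y : S y -> rep (x * rep y) = rep (x * y).
Proof.
move=> Sy; apply: coset_rep_eq; rewrite invgM -mulgA mulKg.
by have [] := coset_repP Sy.
Qed.

Lemma coset_rep_id x : S x -> rep (rep x) = rep x.
Proof. by move=> Sx; rewrite -[rep x]mul1g coset_repMr ?mul1g. Qed.
End CosetRepresentatives.

Section FiniteMod.
Variable G : Group.
Implicit Types (A H K M S : set G) (g x y : G).

Lemma finite_mod_sub S S' M M' :
  S' `<=` S -> M `<=` M' -> finite_mod S M -> finite_mod S' M'.
Proof.
move=> sS sM [C [f fP]]; exists C, f => x y /sS Sx /sS Sy fxy.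
exact/sM/fP.
Qed.

Lemma finite_mod_bigcap (I : finType) S (M : I -> set G) :
  (forall i, finite_mod S (M i)) -> finite_mod S (\bigcap_i M i).
Proof.
move=> finM.
pose C i := sval (cid (finM i)).
pose f i : G -> C i := sval (cid (svalP (cid (finM i)))).
exists {dffun forall i, C i}, (fun x => [ffun i => f i x]) => x y Sx Sy fxy i _.
apply: (svalP (cid (svalP (cid (finM i))))) => //.
by have /(congr1 (fun c : {dffun forall i, C i} => c i)) := fxy; rewrite !ffunE.
Qed.

Lemma finite_mod_trans S M K : is_subgroup G S -> is_subgroup G M ->
  finite_mod S M -> finite_mod (S `&` M) K -> finite_mod S K.
Proof.
move=> sS sM [C [f fP]] [D [h hP]].
pose off x := (coset_rep S M x)^-1 * x.
have offP x : S x -> (S `&` M) (off x).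
  by move=> Sx; have [] := coset_repP sM Sx; split=> //; apply: subgroupVM.
exists (C * D)%type, (fun x => (f x, h (off x))) => x y Sx Sy [fxy hxy].
have := hP _ _ (offP x Sx) (offP y Sy) hxy.
rewrite /off (coset_rep_eq S sM (fP x y Sx Sy fxy)).
by rewrite invgM invgK -mulgA mulVKg.
Qed.

Lemma finite_mod_conj M g :
  finite_mod setT M -> finite_mod setT [set x | M (x ^ g)].
Proof.
move=> [C [f fP]]; exists C, (fun x => f (x ^ g)) => x y _ _ fxy /=.
by rewrite conjMg conjVg; apply: fP.
Qed.

Lemma finite_mod_expg S M x :
  finite_mod S M -> (forall n, S (x ^+ n)) -> exists2 m, 0 < m & M (x ^+ m).
Proof.
move=> [C [f fP]] Sx.
have /injectivePn[i [j neq_ij eq_ij]] :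
    ~~ injectiveb (fun i : 'I_#|C|.+1 => f (x ^+ i)).
  by apply/negP=> /injectiveP/leq_card; rewrite card_ord ltnn.
wlog lt_ij : i j neq_ij eq_ij / i < j.
  move=> IH; case: (ltngtP i j) => [|lt_ji|/val_inj ij]; first exact: IH.
    by apply: IH lt_ji; rewrite // eq_sym.
  by rewrite ij eqxx in neq_ij.
exists (j - i)%N; first by rewrite subn_gt0.
by rewrite -(mulKg (x ^+ i) (x ^+ _)) -expgnDr subnKC ?(ltnW lt_ij) //; apply: fP.
Qed.

Lemma finite_mod1P A : finite_mod A [set 1] ->
  exists2 s : seq G, uniq s & forall x, x \in s <-> A x.
Proof.
move=> [C [f fP]]; pose pre c := xget 1 [set x | A x /\ f x = c].
exists (undup [seq x <- map pre (enum C) | `[< A x >]]) => [|x].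
  exact: undup_uniq.
rewrite mem_undup mem_filter; split=> [/andP[/asboolP]//|Ax]; rewrite asboolT //=.
have [Apre fpre] : A (pre (f x)) /\ f (pre (f x)) = f x.
  by apply: (xgetPex 1 (P := [set y | A y /\ f y = f x])); exists x.
suff -> : x = pre (f x) by rewrite map_f ?mem_enum.
have /= eq1 := fP _ _ Apre Ax fpre.
by rewrite -[LHS](mulVKg (pre (f x))) eq1 mulg1.
Qed.

Lemma finite_mod_transversal S M : is_subgroup G M -> finite_mod S M ->
  exists T, transversal S M T.
Proof.
move=> sM [C [f fP]].
have [|T uniqT memT] := @finite_mod1P [set t | S t /\ coset_rep S M t = t].
  exists C, f => t u [St tK] [Su uK] ftu.
  by rewrite /= -{1}tK (coset_rep_eq S sM (fP _ _ St Su ftu)) uK mulVg.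
by exists T.
Qed.

Lemma transversal_mul_perm S M T y : is_subgroup G S -> is_subgroup G M ->
  transversal S M T -> S y ->
  perm_eq [seq coset_rep S M (y * t) | t <- T] T.
Proof.
move=> sS sM [uniqT memT] Sy; have SyM t (St : S t) := subgroupM sS Sy St.
have uniq_yT : uniq [seq coset_rep S M (y * t) | t <- T].
  rewrite map_inj_in_uniq // => t u /memT[St tK] /memT[Su uK].
  move/(coset_rep_inj sM (SyM t St) (SyM u Su)).
  by rewrite invgM -mulgA mulKg => /(coset_rep_eq S sM); rewrite tK uK.
have sub_yT : {subset [seq coset_rep S M (y * t) | t <- T] <= T}.
  move=> _ /mapP[t /memT[St _] ->]; apply/memT.
  by split; [case: (coset_repP sM (SyM t St)) | apply/(coset_rep_id sM)/SyM].
have [|_ eq_yT] := uniq_min_size uniq_yT sub_yT; first by rewrite size_map.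
exact: uniq_perm.
Qed.

Lemma In_mem (s : seq G) x : List.In x s <-> x \in s.
Proof.
elim: s => [|y s IHs] //=; rewrite inE; split=> [[->|/IHs->]|/orP[/eqP->|/IHs]].
- by rewrite eqxx.
- by rewrite orbT.
- by left.
- by right.
Qed.

Lemma finite_mod1_finite_set A : finite_mod A [set 1] -> finite_set G A.
Proof. by case/finite_mod1P=> s _ sA; exists s => x /sA/In_mem. Qed.

Lemma finite_index_mod H :
  is_subgroup G H -> finite_index G H -> finite_mod setT H.
Proof.
move=> sH [l lP]; have {}lP x : exists t : seq_sub l, H ((val t)^-1 * x).
  by have [t [/In_mem tl Ht]] := lP x; exists (SeqSub tl).
have [f fP] := choice lP; exists (seq_sub l), f => x y _ _ fxy.
by apply: (lcoset_trans sH) (fP y); rewrite -fxy; apply: lcoset_sym.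
Qed.
End FiniteMod.

Definition finitely_generated_mod (G : Group) (A B : set G) :=
  exists s : seq G, [set` s] `<=` A /\ A `<=` gen G ([set` s] `|` B).

Section FiniteIndex.
Variables (G : Group) (H : set G).
Hypotheses (sH : is_subgroup G H) (finH : finite_mod setT H).
Implicit Types g t x : G.

Definition core : set G := [set x | forall g, H (x ^ g)].

Lemma core_sub : core `<=` H.
Proof. by move=> x /(_ 1); rewrite conjg1. Qed.

Lemma core_subgroup : is_subgroup G core.
Proof.
apply: is_subgroup_div => [g|x y Hx Hy g].
  by rewrite conj1g; apply: subgroup1.
by rewrite conjMg conjVg; apply: subgroupF.
Qed.

Lemma core_normal : normal G core.
Proof. by apply/normalP => x g Hx h; rewrite -conjgM; apply: Hx. Qed.

Lemma core_finite_mod : finite_mod setT core.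
Proof.
have [T [_ memT]] := finite_mod_transversal sH finH.
pose M (t : seq_sub T) := [set x | H (x ^ val t)].
apply: (finite_mod_sub (S := setT) (M := \bigcap_t M t)) => //.
  move=> x Hx g; have [_ Hg] := coset_repP (S := setT) sH (I : setT g).
  rewrite -(mulVKg (coset_rep setT H g) g) conjgM; apply: subgroupJ => //.
  have gT : coset_rep setT H g \in T by apply/memT; split=> //; apply: coset_rep_id.
  exact: Hx (SeqSub gT) I.
by apply: finite_mod_bigcap => t; apply: finite_mod_conj.
Qed.

Section Schreier.
Variables l T : seq G.
Hypothesis tvT : transversal setT H T.
Let rep := coset_rep setT H.

Definition schreier_generators : seq G :=
  [seq (rep (s * t))^-1 * (s * t) | s <- l, t <- T].

Let repP x : H ((rep x)^-1 * x).
Proof. by have [] := coset_repP (S := setT) sH (I : setT x). Qed.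

Let repM x y : rep (x * rep y) = rep (x * y).
Proof. exact: coset_repMr. Qed.

Lemma schreier_generators_sub : [set` schreier_generators] `<=` H.
Proof. by move=> _ /allpairsP[[s t] [_ _ ->]]; apply: repP. Qed.

Lemma gen_schreier_generators g t : gen G (fun s => List.In s l) g ->
  rep t = t ->
  gen G [set` schreier_generators] ((rep (g * t))^-1 * (g * t)).
Proof.
set X := [set` _] => gen_g; have sX := gen_subgroup X.
pose U := [set g | forall t, rep t = t -> gen G X ((rep (g * t))^-1 * (g * t))].
suff : U g by apply.
apply: gen_g => [|s /In_mem sl u uK]; last first.
  apply: subset_gen; apply/allpairsP; exists (s, u); split=> //=.
  by have [_ memT] := tvT; apply/memT.
apply: is_subgroup_div => [u uK|x y Ux Uy u uK].
  by rewrite mul1g uK mulVg; apply: subgroup1.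
pose v := rep (y^-1 * u); have vK : rep v = v by apply: coset_rep_id.
have yvK : rep (y * v) = u by rewrite repM mulVKg.
have xvK : rep (x * v) = rep (x * y^-1 * u) by rewrite repM mulgA.
have := subgroupF sX (Ux v vK) (Uy v vK); rewrite yvK xvK.
by rewrite !gnorm.
Qed.

End Schreier.

(* The generators of Reidemeister and Schreier, together with the representative of
   [H], which is only known to lie in [H]. *)
Lemma finite_mod_finitely_generated :
  finitely_generated G -> finitely_generated_mod H set0.
Proof.
move=> [l genl]; have [T tvT] := finite_mod_transversal sH finH.
have [_ Hr] := coset_repP (S := setT) sH (I : setT 1).
pose X := schreier_generators l T; pose r := coset_rep setT H 1.
have {}Hr : H r by rewrite -[r]invgK -[r^-1]mulg1; apply: subgroupV.
exists (r :: X); rewrite setU0; split=> [y /=|x Hx].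
  by rewrite inE => /orP[/eqP->|/schreier_generators_sub].
have := gen_schreier_generators tvT (genl x) (coset_rep_id sH (I : setT 1)).
have -> : coset_rep setT H (x * r) = r.
  apply: coset_rep_eq; rewrite // mulg1.
  by apply: subgroupV => //; apply: subgroupM.
move=> Xx; have sY := gen_subgroup [set` r :: X]; rewrite -(conjgK r x).
apply: (subgroupJ sY); last first.
  by apply: (subgroupV sY); apply: subset_gen; apply: mem_head.
by apply: gen_min Xx => // y yX; apply: subset_gen; apply: mem_behead.
Qed.
End FiniteIndex.

Section CommutatorGenerators.
Variables (G : Group) (H A : set G).
Hypotheses (sH : is_subgroup G H) (sA : is_subgroup G A) (AH : A `<=` H).
Implicit Types (C S W : set G) (a h x : G).

Section CommutatorPreimages.
Variable W : set G.
Hypothesis sW : is_subgroup G W.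
Hypothesis conjW : forall w h, W w -> comm_sub G A H w -> H h -> W (w ^ h).

Let sAH : is_subgroup G (comm_sub G A H) := gen_subgroup _.

Lemma comm_subgroupl h : H h -> is_subgroup G (A `&` [set a | W [~ a, h]]).
Proof.
move=> Hh; apply: is_subgroup_div => [|y z [Ay Wy] [Az Wz]] /=.
  by split; [exact: subgroup1 | rewrite /= comm1g; exact: subgroup1].
split; first exact: subgroupF.
have -> : [~ y * z^-1, h] = ([~ y, h] * [~ z, h]^-1) ^ z^-1.
  by rewrite /commg /conjg !gnorm.
apply: conjW; [exact: subgroupF | | exact/(subgroupV sH)/AH].
by apply: (subgroupF sAH); apply: mem_comm_sub.
Qed.

Lemma comm_subgroupr a : A a -> is_subgroup G (H `&` [set h | W [~ a, h]]).
Proof.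
move=> Aa; apply: is_subgroup_div => [|y z [Hy Wy] [Hz Wz]] /=.
  by split; [exact: subgroup1 | rewrite /= commg1; exact: subgroup1].
split; first exact: subgroupF.
have -> : [~ a, y * z^-1] = ([~ a, z]^-1 * [~ a, y]) ^ z^-1.
  by rewrite /commg /conjg !gnorm.
apply: conjW; [exact: subgroupVM | | exact: subgroupV].
by apply: (subgroupVM sAH); apply: mem_comm_sub.
Qed.
End CommutatorPreimages.

(* Modulo [C] the commutator map [A * H -> [A, H]] is bimultiplicative, and it
   vanishes on [A' * H]. *)
Lemma comm_sub_generated A' C S X :
  (forall c h, comm_sub G A H c -> H h -> C [~ c, h]) ->
  (forall a h, A' a -> H h -> C [~ a, h]) ->
  S `<=` A -> A' `<=` A -> A `<=` gen G (S `|` A') -> X `<=` H -> H `<=` gen G X ->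
  comm_sub G A H `<=` gen G ([set [~ s, x] | s in S & x in X] `|` C).
Proof.
move=> C_comm C_A' SA A'A genS XH genX; set W := gen G _.
have sW : is_subgroup G W := gen_subgroup _.
have CW : C `<=` W by move=> c Cc; apply: subset_gen; right.
have conjW w h : W w -> comm_sub G A H w -> H h -> W (w ^ h).
  move=> Ww Kw Hh; rewrite -[_ ^ _](mulVKg w) -commgEl; apply: (subgroupM sW) => //.
  by apply: CW; apply: C_comm.
have commS s h : S s -> H h -> W [~ s, h].
  move=> Ss /genX; suff : gen G X `<=` H `&` [set h | W [~ s, h]].
    by move=> sub /sub[].
  apply: gen_min => [|x Xx]; first by apply: comm_subgroupr => //; apply: SA.
  by split; [apply: XH | apply: subset_gen; left; exists s => //; exists x].
apply: comm_sub_min => // a h Aa Hh.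
suff : gen G (S `|` A') `<=` A `&` [set a | W [~ a, h]] by case/(_ a (genS _ Aa)).
apply: gen_min => [|s [Ss|A's]]; first exact: comm_subgroupl.
  by split; [apply: SA | apply: commS].
by split; [apply: A'A | apply: CW; apply: C_A'].
Qed.
End CommutatorGenerators.

Lemma gamma_generated (G : Group) (H : set G) n :
  is_subgroup G H -> finitely_generated_mod H set0 ->
  finitely_generated_mod (gamma G H n.+1) (gamma G H n.+2).
Proof.
move=> sH [X [XH]]; rewrite setU0 => genX; elim: n => [|n [s [sG genS]]].
  exists X; split=> // x /genX; apply: gen_min; first exact: gen_subgroup.
  by move=> y Xy; apply: subset_gen; left.
exists [seq [~ y, x] | y <- s, x <- X]; split.
  move=> _ /allpairsP[[y x] /= [sy Xx ->]].
  by apply: gamma_comm; [apply: sG | apply: XH].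
have sub_gen := comm_sub_generated sH (gamma_subgroup sH n.+1) (gamma_sub sH (n := _)).
apply: (subset_trans (sub_gen _ (gamma G H n.+3) _ _ _ _ sG _ genS XH genX)).
- by move=> c h; apply: (gamma_comm (n := n.+1)).
- by move=> a h; apply: (gamma_comm (n := n.+1)).
- exact: gamma_decr.
apply: gen_min; first exact: gen_subgroup.
move=> y [[a sa [x Xx <-]]|Cy]; apply: subset_gen; [left | by right].
by apply/allpairsP; exists (a, x).
Qed.

(** * Homomorphisms to a lattice *)

Definition additive_on (G : Group) (V : zmodType) (A : set G) (phi : G -> V) :=
  forall x y, A x -> A y -> phi (x * y) = (phi x + phi y)%R.

Section AdditiveOn.
Variables (G : Group) (V : zmodType) (A : set G) (phi : G -> V).
Hypotheses (sA : is_subgroup G A) (phiM : additive_on A phi).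
Implicit Types x y : G.

Lemma additive_on1 : phi 1 = 0%R.
Proof.
have := phiM (subgroup1 sA) (subgroup1 sA); rewrite mulg1.
by move/eqP; rewrite -{1}[phi 1]addr0 => /eqP/addrI.
Qed.

Lemma additive_onV x : A x -> phi x^-1 = (- phi x)%R.
Proof.
move=> Ax; apply/eqP; rewrite -addr_eq0 -phiM ?mulVg ?additive_on1 //.
exact: subgroupV.
Qed.

Lemma additive_onF x y : A x -> A y -> phi (x * y^-1) = (phi x - phi y)%R.
Proof. by move=> Ax Ay; rewrite phiM ?additive_onV //; apply: subgroupV. Qed.

Lemma additive_onVM x y : A x -> A y -> phi (x^-1 * y) = (phi y - phi x)%R.
Proof.
by move=> Ax Ay; rewrite phiM ?additive_onV 1?addrC //; apply: subgroupV.
Qed.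

Lemma additive_onX x n : A x -> phi (x ^+ n) = (phi x *+ n)%R.
Proof.
move=> Ax; elim: n => [|n IHn]; first by rewrite additive_on1.
by rewrite expgS phiM ?IHn ?mulrS //; apply: subgroupX.
Qed.

Lemma additive_on_ker_subgroup : is_subgroup G (A `&` [set x | phi x = 0%R]).
Proof.
apply: is_subgroup_div => [|x y [Ax /= x0] [Ay /= y0]].
  by split; [apply: subgroup1 | apply: additive_on1].
split; first exact: subgroupF.
by rewrite /= additive_onF ?x0 ?y0 ?subr0.
Qed.
End AdditiveOn.

Section AbelianSection.
Variables (G : Group) (A B : set G).
Hypotheses (sA : is_subgroup G A) (sB : is_subgroup G B).
Hypothesis commAB : forall x y, A x -> A y -> B [~ x, y].

Let rep := coset_rep A B.

Lemma coset_rep_mulC x y : A x -> A y -> rep (x * y) = rep (y * x).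
Proof.
move=> Ax Ay; apply: coset_rep_eq => //; have := commAB Ay Ax.
by rewrite /commg /conjg !gnorm.
Qed.

Lemma coset_repMl x y : A x -> A y -> rep (rep x * y) = rep (x * y).
Proof.
move=> Ax Ay; have [Arx _] := coset_repP sB Ax.
by rewrite coset_rep_mulC // [LHS](coset_repMr sB) // coset_rep_mulC.
Qed.

Lemma abelian_section : exists (V : zmodType) (pi : G -> V),
  [/\ additive_on A pi, forall v, exists2 x, A x & pi x = v
    & forall x, A x -> (pi x = 0%R <-> B x)].
Proof.
have repMr x y : A y -> rep (x * rep y) = rep (x * y) by apply: coset_repMr.
pose is_rep x := `[< A x /\ rep x = x >]; pose T := {x : G | is_rep x}.
have AT (u : T) : A (val u) by have /asboolP[] := valP u.
have TK (u : T) : rep (val u) = val u by have /asboolP[] := valP u.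
have is_rep_rep x : A x -> is_rep (rep x).
  move=> Ax; have [Arx _] := coset_repP sB Ax.
  by apply/asboolP; split; last exact: coset_rep_id.
pose cls x (Ax : A x) : T := exist (fun x => is_true (is_rep x)) _ (is_rep_rep x Ax).
pose add (u v : T) : T := cls _ (subgroupM sA (AT u) (AT v)).
pose opp (u : T) : T := cls _ (subgroupV sA (AT u)).
pose zero : T := cls _ (subgroup1 sA).
have addC : commutative add by move=> u v; apply/val_inj/coset_rep_mulC.
have addA : associative add.
  move=> u v w; apply: val_inj; have Auv := subgroupM sA (AT u) (AT v).
  have Avw := subgroupM sA (AT v) (AT w).
  by rewrite /= (repMr _ _ Avw) (coset_repMl Auv (AT w)) mulgA.
have add0 : left_id zero add.
  by move=> u; apply: val_inj; rewrite addC /= (repMr _ _ (subgroup1 sA)) mulg1 TK.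
have addN : left_inverse zero opp add.
  move=> u; apply: val_inj; rewrite addC /=.
  by rewrite (repMr _ _ (subgroupV sA (AT u))) mulgV.
pose V : zmodType := HB.pack T (GRing.isZmodule.Build T addA addC add0 addN).
pose pi x : T := insubd zero (rep x).
have piE x : A x -> val (pi x) = rep x.
  by move=> Ax; apply: insubdK; exact: (is_rep_rep x Ax).
exists V, pi; split=> [x y Ax Ay|v|x Ax].
- apply: val_inj; rewrite /= !piE //; last exact: subgroupM.
  by rewrite (repMr _ _ Ay) (coset_repMl Ax Ay).
- by exists (val v); last by apply: val_inj; rewrite piE ?TK.
split=> [/(congr1 val)|Bx].
  rewrite piE //= => /esym/(coset_rep_inj sB (subgroup1 sA) Ax).
  by rewrite invg1 mul1g.
apply: val_inj; rewrite piE //=; apply: coset_rep_eq => //.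
by rewrite mulg1; apply: subgroupV.
Qed.
End AbelianSection.

Definition lattice_map (G : Group) (A B : set G) n (phi : G -> 'rV[int]_n) :=
  [/\ additive_on A phi, forall x, B x -> phi x = 0%R
    & finite_mod (A `&` [set x | phi x = 0%R]) B].

Lemma additive_on_gen_span (G : Group) (V : zmodType) (A B : set G) (pi : G -> V)
    (s : seq G) (a := fun i : 'I_(size s) => pi (tnth (in_tuple s) i)) :
  is_subgroup G A -> additive_on A pi -> [set` s] `<=` A -> B `<=` A ->
  (forall x, B x -> pi x = 0%R) ->
  forall x, gen G ([set` s] `|` B) x ->
    exists c, pi x = lincomb a [set: 'I_(size s)]%SET c.
Proof.
move=> sA piM sS BA piB; pose span v := exists c, v = lincomb a [set: _]%SET c.
have sK : is_subgroup G (A `&` [set x | span (pi x)]).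
  apply: is_subgroup_div => [|x y [Ax [c xc]] [Ay [d yd]]].
    split; first exact: subgroup1.
    by exists 0%R; rewrite lincomb0 (additive_on1 sA piM).
  split; first exact: subgroupF.
  by exists (c - d)%R; rewrite lincombB -xc -yd (additive_onF sA piM).
move=> x; suff: gen G ([set` s] `|` B) `<=` A `&` [set x | span (pi x)].
  by move=> sub /sub[].
apply: gen_min => // y [sy|By].
  split; first exact: sS.
  have /seq_tnthP[i yi] := sy; exists (delta_mx 0 i)%R.
  by rewrite lincomb_delta ?inE // /a -yi.
split; first exact: BA.
by exists 0%R; rewrite lincomb0; apply: piB.
Qed.

Lemma lattice_map_exists (G : Group) (A B : set G) :
  is_subgroup G A -> is_subgroup G B -> B `<=` A ->
  (forall x y, A x -> A y -> B [~ x, y]) -> finitely_generated_mod A B ->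
  exists n (phi : G -> 'rV[int]_n), lattice_map A B phi.
Proof.
move=> sA sB BA commAB [s [sS genA]].
have [V [pi [piM pi_surj ker_pi]]] := abelian_section sA sB commAB.
have piB x : B x -> pi x = 0%R by move=> Bx; apply/ker_pi => //; apply: BA.
pose a (i : 'I_(size s)) := pi (tnth (in_tuple s) i).
have spanV v : exists c, v = lincomb a [set: _]%SET c.
  have [x /genA genx <-] := pi_surj v.
  exact: (additive_on_gen_span sA piM sS BA piB).
have [phi [C [colour inj_phi]]] := finite_kernel_morphism spanV.
exists (size s), (phi \o pi); split=> [x y Ax Ay|x Bx|] /=.
- by rewrite piM // raddfD.
- by rewrite piB ?raddf0.
exists C, (colour \o pi) => x y [Ax /= x0] [Ay /= y0] /= col.
apply/ker_pi; first exact: subgroupVM.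
by rewrite (additive_onVM sA piM) // (inj_phi (pi x) (pi y)) ?subrr ?x0 ?y0.
Qed.

(** * Invariance under conjugation *)

Section LatticeMapConjugation.
Variables (G : Group) (A B : set G) (n : nat) (phi : G -> 'rV[int]_n).
Hypotheses (sA : is_subgroup G A) (nA : normal G A) (nB : normal G B).
Hypothesis phiP : lattice_map A B phi.
Implicit Types a g h x y : G.

Let phiM : additive_on A phi. Proof. by case: phiP. Qed.
Let AJ x g : A x -> A (x ^ g). Proof. exact: (normalP A).1. Qed.

Lemma lattice_map_ker_conj x h : A x -> phi x = 0%R -> phi (x ^ h) = 0%R.
Proof.
move=> Ax x0; have [_ phiB fin_ker] := phiP.
have [k|k k_gt0 Bxk] := finite_mod_expg (x := x) fin_ker.
  by split; [apply: subgroupX | rewrite /= (additive_onX sA phiM) // x0 mul0rn].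
have := phiB _ ((normalP B).1 nB _ h Bxk).
rewrite conjXg (additive_onX sA phiM); last exact: AJ.
exact: mx_mulrn_eq0.
Qed.

Lemma lattice_map_conjMn x y k h : A x -> A y -> phi x = (phi y *+ k)%R ->
  phi (x ^ h) = (phi (y ^ h) *+ k)%R.
Proof.
move=> Ax Ay xy; rewrite -(additive_onX sA phiM) -?conjXg; last exact: AJ.
have Ayk := subgroupX sA k Ay.
have : phi ((x^-1 * y ^+ k) ^ h) = 0%R.
  apply: lattice_map_ker_conj; first exact: subgroupVM.
  by rewrite (additive_onVM sA phiM) // (additive_onX sA phiM) // xy subrr.
rewrite conjMg conjVg (additive_onVM sA phiM); [| exact: AJ..].
by move/eqP; rewrite subr_eq0 => /eqP.
Qed.

Lemma lattice_map_conj_eq x y h : A x -> A y -> phi x = phi y ->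
  phi (x ^ h) = phi (y ^ h).
Proof. exact: (lattice_map_conjMn (k := 1)). Qed.

Variable g : G.

Lemma lattice_map_comm x : A x -> phi [~ x, g] = (phi (x ^ g) - phi x)%R.
Proof. by move=> Ax; rewrite commgEl (additive_onVM sA phiM) //; apply: AJ. Qed.

Let AR x : A x -> A [~ x, g].
Proof. by move=> Ax; rewrite commgEl; apply: subgroupVM => //; apply: AJ. Qed.

Lemma lattice_map_commX x k : A x -> phi [~ x ^+ k, g] = (phi [~ x, g] *+ k)%R.
Proof.
move=> Ax; rewrite !lattice_map_comm //; last exact: subgroupX.
by rewrite conjXg !(additive_onX sA phiM) ?mulrnBl //; apply: AJ.
Qed.

Lemma lattice_map_commX_eq0 x k :
  (0 < k)%N -> A x -> phi [~ x ^+ k, g] = 0%R -> phi [~ x, g] = 0%R.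
Proof.
by move=> k_gt0 Ax; rewrite lattice_map_commX // => /(mx_mulrn_eq0 k_gt0).
Qed.

Lemma lattice_map_conjX a k : A a -> phi [~ a, g, g] = 0%R ->
  phi (a ^ g ^+ k) = (phi a + phi [~ a, g] *+ k)%R.
Proof.
move=> Aa dd0; have Ad := AR Aa.
have phiX := additive_onX sA phiM.
have fix_d : phi ([~ a, g] ^ g) = phi [~ a, g].
  by apply/eqP; rewrite -subr_eq0 -lattice_map_comm ?dd0.
elim: k => [|k IHk]; first by rewrite conjg1 addr0.
have Adk : A ([~ a, g] ^+ k) by apply: subgroupX.
rewrite expgSr conjgM (@lattice_map_conj_eq _ (a * [~ a, g] ^+ k)); first last.
- by rewrite IHk phiM ?phiX.
- exact: subgroupM.
- exact: AJ.
have Adg : A ([~ a, g] ^ g) := AJ g Ad.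
rewrite conjMg conjXg phiM ?phiX ?fix_d //; [| exact: AJ | exact: subgroupX].
by rewrite mulrS addrA lattice_map_comm // subrKC.
Qed.
End LatticeMapConjugation.

Definition nonnormal_nilpotent_or_minimal (G : Group) :=
  forall H, is_subgroup G H -> ~ normal G H ->
    nilpotent G H \/ minimal_non_nilpotent G H.

Section ConjugationInvariance.
Variables (G : Group) (N A B : set G) (n : nat) (phi : G -> 'rV[int]_n).
Hypothesis finN : finite_mod setT N.
Hypotheses (sA : is_subgroup G A) (nA : normal G A).
Hypotheses (nB : normal G B) (BA : B `<=` A).
Hypothesis commAN : forall a x, A a -> N x -> B [~ a, x].
Hypothesis phiP : lattice_map A B phi.
Variable g : G.
Implicit Types a b x y : G.

Let phiM : additive_on A phi. Proof. by case: phiP. Qed.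
Let phiB x : B x -> phi x = 0%R.
Proof. by case: phiP => _ phiB _; apply: phiB. Qed.
Let phiX := additive_onX sA phiM.
Let phi_comm := lattice_map_comm sA nA phiP g.
Let AJ x h : A x -> A (x ^ h). Proof. exact: (normalP A).1. Qed.
Let AR x : A x -> A [~ x, g].
Proof. by move=> Ax; rewrite commgEl; apply: subgroupVM => //; apply: AJ. Qed.

(* A power of [g] lies in [N], so [g] acts on the torsion-free group [phi A] with
   finite order, and a unipotent automorphism of finite order is trivial. *)
Lemma lattice_map_comm2_eq0 a :
  A a -> phi [~ a, g, g] = 0%R -> phi [~ a, g] = 0%R.
Proof.
move=> Aa dd0; have [//|m m_gt0 Ngm] := finite_mod_expg (x := g) finN.
have Bc := commAN Aa Ngm; have := lattice_map_conjX sA nA nB phiP m Aa dd0.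
rewrite -[a ^ _](mulVKg a) -commgEl phiM //; last exact: BA.
by rewrite (phiB Bc) => /addrI/esym/(mx_mulrn_eq0 m_gt0).
Qed.

Definition iter_comm k x := iter k (fun y => [~ y, g]) x.

Lemma lattice_map_iter_comm_eq0 k a :
  A a -> phi (iter_comm k a) = 0%R -> phi [~ a, g] = 0%R.
Proof.
move=> Aa; have Aiter j : A (iter_comm j a) by elim: j => [//|j IHj]; apply: AR.
elim: k => [a0|[|k] IHk] //; last first.
  by move/lattice_map_comm2_eq0 => /(_ (Aiter k))/IHk.
by rewrite phi_comm // [phi a]a0 (lattice_map_ker_conj sA nA nB phiP g Aa a0) subrr.
Qed.

Definition dilation k : set G :=
  A `&` [set x | exists2 b, A b & phi x = (phi b *+ 2 ^ k)%R].

Lemma dilation_subgroup k : is_subgroup G (dilation k).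
Proof.
apply: is_subgroup_div => [|x y [Ax [b Ab xb]] [Ay [c Ac yc]]].
  split; first exact: subgroup1.
  by exists 1; rewrite ?(additive_on1 sA phiM) ?mul0rn //; apply: subgroup1.
split; first exact: subgroupF.
exists (b * c^-1); first exact: subgroupF.
by rewrite !(additive_onF sA phiM) // xb yc mulrnBl.
Qed.

Lemma dilation_conj k x h : dilation k x -> dilation k (x ^ h).
Proof.
move=> [Ax [b Ab xb]]; split; first exact: AJ.
exists (b ^ h); first exact: AJ.
exact: (lattice_map_conjMn sA nA nB phiP).
Qed.

(* [L_k] in the introduction. Any subgroup of the centraliser of [g] that contains
   [g] would do as the second factor. *)
Definition dilation_cent k := prod_set (dilation k) (centralizer [set g]).

Lemma dilation_cent_subgroup k : is_subgroup G (dilation_cent k).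
Proof.
apply: prod_subgroup (dilation_subgroup k) (centralizer_subgroup _) _ => x c Dx _.
exact: dilation_conj.
Qed.

Lemma mem_dilation_cent k : dilation_cent k g.
Proof. by apply: prod_subr (dilation_subgroup k) _ _ => x ->. Qed.

Lemma dilation_cent_expg k a : A a -> dilation_cent k (a ^+ (2 ^ k)).
Proof.
move=> Aa; apply: prod_subl; first exact: centralizer_subgroup.
by split; [apply: subgroupX | exists a; rewrite // phiX].
Qed.

Lemma dilation_cent_decr k j : dilation_cent (k + j) `<=` dilation_cent k.
Proof.
move=> _ [x [Ax [b Ab xb]] [c cg <-]]; exists x; last by exists c.
split=> //; exists (b ^+ (2 ^ j)); first exact: subgroupX.
by rewrite xb phiX // -mulrnA -expnD addnC.
Qed.

Lemma dilation_cent_divisible k x : A x -> dilation_cent k x ->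
  exists b, phi [~ x, g] = (phi b *+ 2 ^ k)%R.
Proof.
move=> Ax [y [Ay [b Ab yb]] [c cg yc]]; exists [~ b, g].
have Ac : A c by apply: (subgroupKM sA Ay); rewrite yc.
have cJ : c ^ g = c by rewrite /conjg -(cg g) // mulKg.
rewrite !phi_comm // -yc conjMg cJ (phiM (AJ g Ay) Ac) (phiM Ay Ac).
rewrite (lattice_map_conjMn sA nA nB phiP g Ay Ab yb) [(phi y + _)%R]addrC addrKA.
by rewrite yb mulrnBl.
Qed.

Lemma dilation_cent_fixed k x : A x -> (forall j, dilation_cent (k + j) x) ->
  phi [~ x, g] = 0%R.
Proof.
move=> Ax Lx; apply: mx_divisible_eq0 => j.
have [b ->] := dilation_cent_divisible Ax (Lx j).
by exists (phi b *+ 2 ^ k)%R; rewrite -mulrnA -expnD.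
Qed.

Lemma dilation_cent_nilpotent k a :
  nilpotent G (dilation_cent k) -> A a -> phi [~ a, g] = 0%R.
Proof.
move=> [m trivial_m] Aa; have Aak := subgroupX sA (2 ^ k) Aa.
have mem_gamma j : gamma G (dilation_cent k) j.+1 (iter_comm j (a ^+ (2 ^ k))).
  elim: j => [|j IHj]; first exact: dilation_cent_expg.
  by apply: gamma_comm => //; apply: mem_dilation_cent.
have iter1 := trivial_m _ (gamma_decr (dilation_cent_subgroup k) (mem_gamma m)).
apply: (lattice_map_commX_eq0 sA nA phiP (expn_gt0 2 k)) => //.
apply: (lattice_map_iter_comm_eq0 (k := m)) => //.
by rewrite iter1 (additive_on1 sA phiM).
Qed.

Hypothesis nilpotent_or_minimalG : nonnormal_nilpotent_or_minimal G.

Lemma lattice_map_comm_eq0 a : A a -> phi [~ a, g] = 0%R.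
Proof.
move=> Aa; have [[k nil_k]|not_nil] := EM (exists k, nilpotent G (dilation_cent k)).
  exact: dilation_cent_nilpotent nil_k Aa.
have [normalL|/existsNP[k not_normal]] := EM (forall k, normal G (dilation_cent k)).
  apply: lattice_map_comm2_eq0 => //.
  apply: (dilation_cent_fixed (k := 0%N)) => [|k]; first exact: AR.
  have sL := dilation_cent_subgroup k; have Lg := mem_dilation_cent k.
  rewrite commgEr; apply: (subgroupM sL) => //.
  by apply: (normalP _).1 => //; apply: subgroupV.
have sL := dilation_cent_subgroup k; have Aak := subgroupX sA (2 ^ k) Aa.
have [nil_k|[_ minimal_k]] := nilpotent_or_minimalG sL not_normal.
  by case: not_nil; exists k.
have Lak j : dilation_cent (k + j) (a ^+ (2 ^ k)).
  apply: contrapT => not_mem; case: not_nil; exists (k + j)%N.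
  apply: minimal_k; first exact: dilation_cent_subgroup.
  split; first exact: dilation_cent_decr.
  by exists (a ^+ (2 ^ k)); split=> //; apply: dilation_cent_expg.
apply: (lattice_map_commX_eq0 sA nA phiP (expn_gt0 2 k)) => //.
exact: dilation_cent_fixed Aak Lak.
Qed.

Lemma lattice_map_conj_invariant a : A a -> phi (a ^ g) = phi a.
Proof.
move=> Aa; apply/eqP; rewrite -subr_eq0 -phi_comm //.
exact/eqP/lattice_map_comm_eq0.
Qed.
End ConjugationInvariance.

(** * Transfer *)

Section Transfer.
Variables (G : Group) (V : zmodType) (H A : set G) (phi : G -> V).
Hypotheses (sH : is_subgroup G H) (sA : is_subgroup G A) (finA : finite_mod H A).
Hypothesis AJ : forall a h, A a -> H h -> A (a ^ h).
Hypothesis phiM : additive_on A phi.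
Hypothesis phiJ : forall a h, A a -> H h -> phi (a ^ h) = phi a.
Implicit Types x : G.

Lemma transfer : exists (psi : G -> V) (m : nat),
  [/\ 0 < m, additive_on H psi & forall x, H x -> A x -> psi x = (phi x *+ m)%R].
Proof.
pose rep := coset_rep H A.
have [T tvT] := finite_mod_transversal sA finA; have [_ memT] := tvT.
have repH x : H x -> H (rep x) by move=> /(coset_repP sA)[].
have repA x : H x -> A ((rep x)^-1 * x) by move=> /(coset_repP sA)[].
have TH t : t \in T -> H t by move/memT=> [].
pose term x t := phi ((rep (x * t))^-1 * (x * t)).
exists (fun x => \sum_(t <- T) term x t)%R, (size T); split=> [|x y Hx Hy|x Hx Ax].
- have H1 := subgroup1 sH; have : rep 1 \in T.
    by apply/memT; split; [exact: repH | exact: coset_rep_id].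
  by case: (T).
- have -> : (\sum_(t <- T) term x t = \sum_(t <- T) term x (rep (y * t)%g))%R.
    by rewrite -(perm_big _ (transversal_mul_perm sH sA tvT Hy)) big_map.
  rewrite -big_split; apply: eq_big_seq => t tT /=.
  have Hyt := subgroupM sH Hy (TH t tT); have Hxyt := subgroupM sH Hx (repH _ Hyt).
  rewrite /term -phiM; [| exact: repA..].
  by rewrite /rep (coset_repMr sA x Hyt) !mulgA mulgK.
rewrite (eq_big_seq (fun _ => phi x)) => [|t tT].
  by rewrite big_const_seq count_predT iter_addr_0.
have [Ht tK] := (memT t).1 tT; rewrite /term.
have -> : rep (x * t) = t.
  rewrite -[RHS]tK; apply: (coset_rep_eq H sA); rewrite invgM -mulgA.
  exact: AJ (subgroupV sA Ax) Ht.
exact: phiJ.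
Qed.
End Transfer.

Section LatticeTransfer.
Variables (G : Group) (H A B : set G) (n : nat) (phi : G -> 'rV[int]_n).
Hypotheses (sH : is_subgroup G H) (nH : normal G H).
Hypotheses (sA : is_subgroup G A) (nA : normal G A) (finA : finite_mod H A).
Hypotheses (phiP : lattice_map A B phi).
Hypothesis phiJ : forall a g, A a -> phi (a ^ g) = phi a.

(* The transfer is [G]-invariant as well, so [[H, G]] lies in its kernel. *)
Lemma finite_mod_comm_sub : finite_mod (comm_sub G H setT) B.
Proof.
have [phiM _ fin_ker] := phiP.
have AJ := (normalP A).1 nA; have HJ := (normalP H).1 nH.
have [psi [m [m_gt0 psiM psiA]]] :=
  transfer sH sA finA (fun a h Aa _ => AJ a h Aa) phiM (fun a h Aa _ => phiJ h Aa).
pose K := H `&` [set x | psi x = 0%R].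
have sK : is_subgroup G K by apply: additive_on_ker_subgroup.
have commK : comm_sub G H setT `<=` K.
  apply: comm_sub_min => // h g Hh _; have Hhg := HJ h g Hh.
  split; first by rewrite commgEl; apply: subgroupVM.
  rewrite /= commgEl (additive_onVM sH psiM) //; apply/eqP; rewrite subr_eq0.
  have [k|k k_gt0 Ahk] := finite_mod_expg (x := h) finA; first exact: subgroupX.
  have psi_k : psi ((h ^+ k) ^ g) = psi (h ^+ k).
    have Hhk := subgroupX sH k Hh.
    by rewrite !psiA ?phiJ //; [apply: HJ | apply: AJ].
  move/eqP: psi_k; rewrite conjXg !(additive_onX sH psiM) // -subr_eq0 -mulrnBl.
  by move/eqP/(mx_mulrn_eq0 k_gt0)/eqP; rewrite subr_eq0.
apply: finite_mod_sub commK (@subset_refl _ _) _.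
apply: (finite_mod_trans sK sA); first by apply: finite_mod_sub finA => // x [].
apply: finite_mod_sub fin_ker => // x [[Hx /= psi0] Ax]; split=> //=.
by move: psi0; rewrite psiA // => /(mx_mulrn_eq0 m_gt0).
Qed.
End LatticeTransfer.

Section VirtuallyNilpotent.
Variables (G : Group) (N : set G).
Hypotheses (sN : is_subgroup G N) (nN : normal G N) (finN : finite_mod setT N).
Hypotheses (fgN : finitely_generated_mod N set0) (nilN : nilpotent G N).

Lemma nilpotent_gamma_trivial : exists c, gamma G N c.+1 `<=` [set 1].
Proof. by have [c trivial_c] := nilN; exists c => x /(gamma_decr sN)/trivial_c. Qed.

Lemma gamma_lattice_map i :
  exists n (phi : G -> 'rV[int]_n),
    lattice_map (gamma G N i.+1) (gamma G N i.+2) phi.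
Proof.
apply: lattice_map_exists; try exact: gamma_subgroup.
- exact: gamma_decr.
- by move=> x y Nx /(gamma_sub sN); apply: gamma_comm.
- exact: gamma_generated.
Qed.

Lemma finite_gamma : nonnormal_nilpotent_or_minimal G ->
  exists n, finite_mod (gamma G setT n.+1) [set 1].
Proof.
move=> nilpotent_or_minimalG; have [c trivial_c] := nilpotent_gamma_trivial.
suff fin_mod i : exists n, finite_mod (gamma G setT n.+1) (gamma G N i.+1).
  have [n fin_n] := fin_mod c; exists n.
  exact: finite_mod_sub (@subset_refl _ _) trivial_c fin_n.
elim: i => [|i [n fin_n]]; first by exists 0%N.
have [k [phi phiP]] := gamma_lattice_map i; exists n.+1.
have sNi j := gamma_subgroup sN j.
have nNi j : normal G (gamma G N j) by apply: gamma_normal.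
have phiJ a g : gamma G N i.+1 a -> phi (a ^ g) = phi a.
  apply: (lattice_map_conj_invariant finN (B := gamma G N i.+2)) => //.
    exact: gamma_decr.
  by move=> b x; apply: gamma_comm.
apply: (finite_mod_comm_sub (H := gamma G setT n.+1)) phiJ => //.
  exact: gamma_subgroup.
exact: gamma_normal.
Qed.

Lemma finite_torsion : (forall x : G, exists2 m, 0 < m & x ^+ m = 1) ->
  finite_mod setT [set (1 : G)].
Proof.
move=> torsion; have [c trivial_c] := nilpotent_gamma_trivial.
suff fin_mod i : finite_mod setT (gamma G N i.+1).
  exact: finite_mod_sub (@subset_refl _ _) trivial_c (fin_mod c).
elim: i => [//|i IHi]; apply: (finite_mod_trans _ (gamma_subgroup sN _) IHi) => //.
have [k [phi [phiM _ fin_ker]]] := gamma_lattice_map i.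
apply: finite_mod_sub fin_ker => // x [_ Nx]; split=> //=.
have [m m_gt0 xm1] := torsion x.
have sNi := gamma_subgroup sN i.+1.
have := additive_onX sNi phiM m Nx.
by rewrite xm1 (additive_on1 sNi phiM) => /esym/(mx_mulrn_eq0 m_gt0).
Qed.

Lemma exists_infinite_order : ~ finite_mod setT [set (1 : G)] ->
  exists x : G, infinite_order x.
Proof.
move=> infG; apply: contrapT => /forallNP torsion; apply/infG/finite_torsion => x.
by have /existsNP[m /not_implyP[m_gt0 /contrapT xm1]] := torsion x; exists m.
Qed.
End VirtuallyNilpotent.

(** * Finite subgroups *)

Section FiniteGroupImage.
Variables (gT : finGroupType) (G : Group) (f : UMagmaMorphism.type gT G).
Hypothesis injf : injective f.
Implicit Types (A B S : {set gT}) (X : {group gT}).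

Definition group_image A : set G := f @` [set` A].

Lemma group_image_subgroup X : is_subgroup G (group_image X).
Proof.
apply: is_subgroup_div => [|_ _ [x Xx <-] [y Xy <-]].
  by exists 1; [exact: group1 | exact: gmulf1].
by exists (x * y^-1); [apply: groupM; rewrite ?groupV | rewrite gmulfM gmulfV].
Qed.

Lemma group_image_gen S : group_image <<S>> = gen G (group_image S).
Proof.
apply/seteqP; split=> [_ [x Sx <-] K sK SK|]; last first.
  apply: gen_min; first exact: (group_image_subgroup <<S>>).
  by move=> _ [x Sx <-]; exists x; rewrite //= mem_gen.
have gK : group_set [set x | `[< K (f x) >]]%SET.
  apply/group_setP; split=> [|y z]; rewrite !inE.
    by rewrite gmulf1; apply: subgroup1.
  by rewrite gmulfM; apply: subgroupM.
suff /fintype.subsetP/(_ x Sx) : <<S>> \subset fingroup.Group gK.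
  by rewrite inE => /asboolP.
rewrite gen_subG; apply/fintype.subsetP => y Sy.
by rewrite !inE; apply: SK; exists y.
Qed.

Lemma group_image_comm A B :
  group_image [~: A, B] = comm_sub G (group_image A) (group_image B).
Proof.
rewrite group_image_gen; congr gen; apply/seteqP; split.
  move=> _ [_ /imset2P[x y Ax By ->] <-]; exists (f x), (f y).
  by rewrite comm_elE gmulfR; split; [exists x | split; [exists y |]].
move=> _ [_ [_ [[x Ax <-] [[y By <-] ->]]]]; exists [~ x, y].
  exact: imset2_f.
by rewrite comm_elE gmulfR.
Qed.

Lemma group_image_lcn X n : group_image 'L_n.+1(X) = gamma G (group_image X) n.+1.
Proof. by elim: n => [|n IHn]; rewrite ?lcn1 // lcnSn group_image_comm IHn. Qed.

Lemma group_image_der X n : group_image X^`(n) = derived G (group_image X) n.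
Proof. by elim: n => [|n IHn]; rewrite ?derg0 // dergSn group_image_comm IHn. Qed.

Lemma group_image_nilpotent X :
  nilpotent G (group_image X) -> nilpotent.nilpotent X.
Proof.
move=> [n trivial_n]; apply/lcnP; exists n; apply/trivgP/fintype.subsetP => x Lx.
rewrite inE; apply/eqP/injf; rewrite gmulf1; apply: trivial_n.
apply: (gamma_decr (group_image_subgroup X)); rewrite -group_image_lcn.
by exists x.
Qed.

Lemma group_image_soluble X : solvable X -> soluble G (group_image X).
Proof.
move=> /derivedP[n der_n]; exists n => x; rewrite -group_image_der der_n.
by case=> y /set1P-> <-; apply: gmulf1.
Qed.

Lemma group_image_normal X :
  (forall x y, group_image X x -> group_image X (x ^ f y)) -> X <| [set: gT]%SET.
Proof.
move=> nX; apply/andP; split; first exact: finset.subsetT.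
apply/fintype.subsetP => y _; rewrite inE.
apply/fintype.subsetP => _ /imsetP[x Xx ->].
have [|z Xz] := nX (f x) y; first by exists x.
by rewrite -gmulfJ => /injf <-.
Qed.
End FiniteGroupImage.

Section FiniteSubgroup.
Variables (G : Group) (F : set G).
Hypotheses (sF : is_subgroup G F) (finF : finite_mod F [set 1]).

Lemma finite_subgroup_image :
  exists (gT : finGroupType) (f : UMagmaMorphism.type gT G),
  injective f /\ group_image f [set: gT]%SET = F.
Proof.
have [s _ sE] := finite_mod1P finF.
have closed_s : group_closed (mem s).
  by split=> [|x y /sE Fx /sE Fy]; apply/sE; [apply: subgroup1 | apply: subgroupF].
pose gT : finGroupType := HB.pack (seq_sub s)
  (SubChoice_isSubGroup.Build G (mem s) (seq_sub s) closed_s).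
pose val_morph := isGroupMorphism.Build gT G val (fun _ _ => erefl).
exists gT, (HB.pack_for (UMagmaMorphism.type gT G) (val : gT -> G) val_morph).
split; first exact: val_inj.
apply/seteqP; split=> [_ [x _ <-]|x /sE sx]; first by apply/sE/(valP x).
by exists (SeqSub sx) => //=; rewrite inE.
Qed.

Lemma soluble_nilpotent_or_normal :
  (forall X, is_subgroup G X -> X `<=` F ->
    nilpotent G X \/ forall x y, X x -> F y -> X (x ^ y)) ->
  soluble G F.
Proof.
move=> nilF; have [gT [f [injf imF]]] := finite_subgroup_image.
rewrite -imF; apply: group_image_soluble.
apply: solvable_nilpotent_or_normal => X _.
have [|nilX|nX] := nilF _ (group_image_subgroup f X).
- by rewrite -imF => _ [x _ <-]; exists x; rewrite //= inE.
- by left; apply: group_image_nilpotent nilX.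
right; apply: (group_image_normal injf) => x y Xx.
by apply: nX => //; rewrite -imF; exists y; rewrite //= inE.
Qed.
End FiniteSubgroup.

(** * Insoluble groups *)

Lemma expg_infinite_order_inj (G : Group) (z : G) :
  infinite_order z -> injective (fun n => z ^+ n).
Proof.
move=> infz m n; wlog le_mn : m n / m <= n => [IH|] eq_z.
  by case/orP: (leq_total m n) => [/IH->|/IH->].
apply/eqP; rewrite eqn_leq le_mn leqNgt -subn_gt0; apply/negP=> /infz[].
by rewrite expgnFr // -eq_z mulgV.
Qed.

Section CyclicFactor.
Variables (G : Group) (F : set G) (z : G).
Hypotheses (sF : is_subgroup G F) (finF : finite_mod F [set 1]).
Hypotheses (infz : infinite_order z) (commF : centralizer F z).
Implicit Types (X : set G) (x y : G).

Lemma powers_finite_eq1 y : powers z y -> F y -> y = 1.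
Proof.
move=> [m [n ->]] Fy.
have [k|k k_gt0 /=] := finite_mod_expg (x := z ^+ m * z ^- n) finF.
  exact: subgroupX.
rewrite expgnFl; last exact: commuteX2.
move/divg1_eq; rewrite -!expgnA => /(expg_infinite_order_inj infz)/eqP.
by rewrite eqn_pmul2r // => /eqP->; rewrite mulgV.
Qed.

(* [X <z>] properly contains the non-nilpotent group [X], so it is not minimal
   non-nilpotent; it is therefore normal, and it meets [F] in [X]. *)
Lemma nonnilpotent_normal X : nonnormal_nilpotent_or_minimal G ->
  is_subgroup G X -> X `<=` F -> ~ nilpotent G X ->
  forall x y, X x -> F y -> X (x ^ y).
Proof.
move=> nilpotent_or_minimalG sX XF not_nil.
have commXZ : powers z `<=` centralizer X.
  by apply: powers_min; [apply: centralizer_subgroup | move=> x /XF; apply: commF].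
have sZ := powers_subgroup z; pose XZ := prod_set X (powers z).
have sXZ : is_subgroup G XZ.
  apply: prod_subgroup => // x y Xx Zy.
  by have /commgP/conjg_fixP-> := commXZ y Zy x Xx.
have XXZ : X `<=` XZ := prod_subl sZ.
have XZz : XZ z := prod_subr sX (mem_powers z).
have not_Fz : ~ F z.
  move=> Fz; have [|m m_gt0 /(infz m_gt0)//] := finite_mod_expg (x := z) finF.
  by move=> k; apply: subgroupX.
have normalXZ : normal G XZ.
  apply: contrapT => not_normal.
  have [/(nilpotent_sub XXZ)//|[_]] := nilpotent_or_minimalG _ sXZ not_normal.
  move/(_ X sX) => nilX; apply/not_nil/nilX.
  by split=> //; exists z; split=> // /XF.
move=> x y Xx Fy; have [u Xu [w Zw uw]] := (normalP XZ).1 normalXZ x y (XXZ x Xx).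
have Fw : F w.
  apply: (subgroupKM sF (XF u Xu)); rewrite uw.
  by apply: subgroupJ => //; apply: XF.
by rewrite -uw (powers_finite_eq1 Zw Fw) mulg1.
Qed.
End CyclicFactor.

Lemma finite_mod_centralizer (G : Group) (F : set G) :
  normal G F -> finite_mod F [set 1] -> finite_mod setT (centralizer F).
Proof.
move=> /normalP nF /finite_mod1P[s _ sE].
have sJ (x : seq_sub s) g : val x ^ g \in s by apply/sE/nF/sE/valP.
exists {ffun seq_sub s -> seq_sub s}, (fun g => [ffun x => SeqSub (sJ x g^-1)]).
move=> g h _ _ /ffunP eq_gh x /sE sx; apply/commgP/conjg_fixP.
have /(congr1 val) /= := eq_gh (SeqSub sx); rewrite !ffunE /= conjgM => ->.
exact: conjgKV.
Qed.

Lemma finite_normal_soluble (G : Group) (F : set G) (a : G) :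
  nonnormal_nilpotent_or_minimal G -> is_subgroup G F -> normal G F ->
  finite_mod F [set 1] -> infinite_order a -> soluble G F.
Proof.
move=> nilpotent_or_minimalG sF nF finF inf_a.
have [//|m m_gt0 commF] := finite_mod_expg (x := a) (finite_mod_centralizer nF finF).
apply: (soluble_nilpotent_or_normal sF finF) => X sX XF.
have [|not_nil] := EM (nilpotent G X); [by left | right].
apply: (nonnilpotent_normal sF finF _ commF nilpotent_or_minimalG) => // k k_gt0.
by rewrite -expgnA; apply: inf_a; rewrite muln_gt0 m_gt0.
Qed.

Unset Implicit Arguments.
Local Open Scope coq_nat_scope.

Theorem mainTheorem12 (G : Group) :
  finitely_generated G ->
  para_Nil_Hamiltonian G ->
  (exists H, is_subgroup G H /\ nilpotent G H /\ finite_index G H) ->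
  (exists n, 1 <= n /\ finite_set G (gamma G (whole G) n)) /\
  (~ soluble G (whole G) -> finite_set G (whole G)).
Proof.
move=> fgG [_ nilpotent_or_minimalG] [H [sH [nilH /(finite_index_mod sH) finH]]].
have sN := core_subgroup sH; have nN : normal G (core H) by apply: core_normal.
have finN := core_finite_mod sH finH.
have nilN := nilpotent_sub (@core_sub G H) nilH.
have fgN := finite_mod_finitely_generated sN finN fgG.
have [n finF] := finite_gamma sN nN finN fgN nilN nilpotent_or_minimalG.
split; first by exists n.+1; split; [apply/leP | apply: finite_mod1_finite_set].
move=> insoluble; apply: finite_mod1_finite_set; apply: contrapT.
move=> /(exists_infinite_order sN finN fgN nilN)[a inf_a]; apply: insoluble.
have sF : is_subgroup G (gamma G (whole G) n.+1) by apply: gamma_subgroup.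
have nF : normal G (gamma G (whole G) n.+1) by apply: gamma_normal.
exact: soluble_gamma (finite_normal_soluble nilpotent_or_minimalG sF nF finF inf_a).
Qed.
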